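(* Fix $q\in(0,1)$ and let $(\Gamma_n)$ be a sequence of graphs. For $d\ge1$ define $$m_d(\Gamma_n)=\big|\{u\in v(\Gamma_n):\deg_{\Gamma_n}(u)\ge d\}\big|,\qquad \kappa(\Gamma_n)=\max_{d\ge1}m_d(\Gamma_n)\,d^2 .$$ Fix $d\in\{1,\dots,d_{\max}(\Gamma_n)\}$ and define $$m=\left\lceil C_1\frac{n^2}{d^2}\log n\right\rceil,\qquad M=\min\left\{n,\left\lceil C_2\frac{n}{m_d(\Gamma_n)}\log n\right\rceil\right\},\qquad Q_{\mathrm{cut}}=Mm ,$$ where $C_1,C_2>0$ are sufficiently large constants depending only on $q$. Assume the feasibility conditions $$m\le\frac n2\qquad\text{and}\qquad \frac{|v(\Gamma_n)|\,m}{n}\ge10\log n .$$ Then there exists a non-adaptive query set $\mathcal Q_n$ of size $|\mathcal Q_n|\le Q_{\mathrm{cut}}$ such that the degree-on-a-cut test $\mathcal A_{\mathrm{cut}}$ (with parameters $(M,m,d)$) satisfies $R_n(\mathcal A_{\mathrm{cut}};\mathcal Q_n)\to0$ as $n\to\infty$.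
   Context: Setup. $\Gamma_n$ is an undirected graph without isolated vertices, with $|v(\Gamma_n)|\le n$; $d_{\max}(\Gamma_n)$ is its maximum degree and $\deg_{\Gamma_n}(u)$ the degree of $u$. Under $\mathcal H_0$, $G$ is a random graph on $[n]=\{1,\dots,n\}$ in which each pair in $\binom{[n]}{2}$ is an edge independently with probability $q$. Under $\mathcal H_1$, a copy $\Gamma_n^\star$ is drawn uniformly from the set of all subgraphs of the complete graph on $[n]$ isomorphic to $\Gamma_n$; all edges of $\Gamma_n^\star$ are in $G$, and every other pair is an edge independently with probability $q$. A query of a pair reveals whether it is an edge of $G$; all queries are chosen in advance (non-adaptively), possibly at random. Degree-on-a-cut test with parameters $(M,m,d)$: sample $S\subset[n]$ uniformly at random with $|S|=m$; sample $U\subset[n]\setminus S$ uniformly at random with $|U|=M$, independently of $S$; query all pairs $(u,s)$ with $u\in U$, $s\in S$ (a total of $Mm$ queries); for each $u\in U$ compute $D(u)=\sum_{s\in S}\mathbf 1\{(u,s)\in e(G)\}$; set the threshold $T=qm+\frac{(1-q)dm}{8n}$; output $1$ if $\max_{u\in U}D(u)\ge T$, and $0$ otherwise. Risk: $R_n(\mathcal A;\mathcal Q_n)=\mathbb P_{\mathcal H_0}(\mathcal A=1)+\mathbb P_{\mathcal H_1}(\mathcal A=0)$, the sum of the type-I and type-II error probabilities of the test $\mathcal A$ based on the answers to the queries in $\mathcal Q_n$.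
   Formalization: When M+m>n no U⊂[n]∖S with |U|=M exists (e.g. a star, where M=n), so the test is undefined; in that case U is instead a uniform M-subset of [n] independent of S, pairs u=s contributing nothing. When M+m≤n the test is as stated. *)

(* Defs.v *)
From HB Require Import structures.
From mathcomp Require Import all_boot all_order all_algebra.
From mathcomp Require Import all_classical all_reals all_analysis.

Set Implicit Arguments.
Unset Strict Implicit.
Unset Printing Implicit Defensive.

Import Order.TTheory GRing.Theory Num.Theory.
Import numFieldNormedType.Exports.
Local Open Scope ring_scope.

Record sgraph := SGraph {
  vert :> finType;
  adj : rel vert;
  adj_sym : symmetric adj;
  adj_irr : irreflexive adj }.

Section Graphs.
Variable G : sgraph.

Definition deg (x : G) : nat := #|[set y | adj x y]|.

Definition max_deg : nat := \max_(x : G) deg x.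

Definition no_isolated : Prop := forall x : G, (0 < deg x)%N.

Definition num_deg_ge (d : nat) : nat := #|[set x : G | (d <= deg x)%N]|.

End Graphs.

Arguments num_deg_ge G d : clear implicits.

Section Model.
Variables (R : realType) (n : nat).

(* A graph on [n] is identified with its edge set, a set of two-element
   subsets of 'I_n. *)
Definition pairs : {set {set 'I_n}} := [set p : {set 'I_n} | #|p| == 2%N].

(* A subgraph of the complete graph on [n]: a vertex set H.1 together with a
   set H.2 of pairs of elements of H.1. *)
Definition is_subgraph (H : {set 'I_n} * {set {set 'I_n}}) : bool :=
  H.2 \subset [set p in pairs | p \subset H.1].

Definition isomorphic_to (G : sgraph)
    (H : {set 'I_n} * {set {set 'I_n}}) : bool :=
  [exists f : {ffun G -> 'I_n},
    [&& injectiveb f, f @: [set: G] == H.1 &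
        [forall x, forall y, adj x y == ([set f x; f y] \in H.2)]]].

Definition copies (G : sgraph) : {set ({set 'I_n} * {set {set 'I_n}})} :=
  [set H | is_subgraph H && isomorphic_to G H].

(* Probability of drawing exactly the edge set E when the pairs in F are edges
   for sure and the other pairs are edges independently with probability q. *)
Definition planted_mass (q : R) (F E : {set {set 'I_n}}) : R :=
  \prod_(p in pairs)
    (if p \in F then (p \in E)%:R else if p \in E then q else 1 - q).

Definition mass_H0 (q : R) (E : {set {set 'I_n}}) : R := planted_mass q finset.set0 E.

Definition mass_H1 (q : R) (G : sgraph) (E : {set {set 'I_n}}) : R :=
  (\sum_(H in copies G) planted_mass q H.2 E) / #|copies G|%:R.

(* A randomized non-adaptive procedure draws a seed w uniformly from Omega,
   independently of the observed graph, queries the pairs in Q w, and outputs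
   A w a, where a is the set of queried pairs that turn out to be edges. *)
Definition prob_output (W : finType) (Omega : {set W})
    (mass : {set {set 'I_n}} -> R) (A : W -> {set {set 'I_n}} -> bool)
    (Q : W -> {set {set 'I_n}}) (b : bool) : R :=
  \sum_(E in powerset pairs)
    mass E * ((\sum_(w in Omega) (A w (E :&: Q w) == b)%:R) / #|Omega|%:R).

Definition risk (q : R) (G : sgraph) (W : finType) (Omega : {set W})
    (A : W -> {set {set 'I_n}} -> bool) (Q : W -> {set {set 'I_n}}) : R :=
  prob_output Omega (mass_H0 q) A Q true +
  prob_output Omega (mass_H1 q G) A Q false.

(* Seeds w = (S, U) of the degree-on-a-cut test.  Each S leaves the same number
   of choices for U, so a uniform seed amounts to S uniform of size m followed
   by U uniform of size M in the complement of S.  When M > n - m (which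
   M = min(n, _) permits, e.g. M = n) no M-subset avoids S; U is then a uniform
   M-subset of [n] independent of S.  Taking U to be the whole complement of S
   instead would not do: the only vertex of large degree of a planted star is
   in S with probability m / n, which may be close to 1/2. *)
Definition cut_seeds (M m : nat) : {set {set 'I_n} * {set 'I_n}} :=
  [set w : {set 'I_n} * {set 'I_n} |
    [&& #|w.1| == m, #|w.2| == M &
        (M + m <= n)%N ==> (w.2 \subset ~: w.1)]].

Definition cut_queries (w : {set 'I_n} * {set 'I_n}) : {set {set 'I_n}} :=
  [set p in pairs | [exists u in w.2, exists s in w.1, p == [set u; s]]].

(* If u \in S then [set u; u] is not a pair, so s = u never contributes. *)
Definition cut_degree (S : {set 'I_n}) (a : {set {set 'I_n}}) (u : 'I_n) : nat :=
  #|[set s in S | [set u; s] \in a]|.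

Definition cut_threshold (q : R) (m d : nat) : R :=
  q * m%:R + (1 - q) * d%:R * m%:R / (8 * n%:R).

Definition cut_test (q : R) (m d : nat) (w : {set 'I_n} * {set 'I_n})
    (a : {set {set 'I_n}}) : bool :=
  cut_threshold q m d <= (\max_(u in w.2) cut_degree w.1 a u)%:R.

End Model.

Arguments pairs n : clear implicits.
Arguments cut_seeds n M m : clear implicits.
Arguments cut_queries {n} w.
Arguments cut_test {R n} q m d w a.

(* Both ceilings are of nonnegative reals, so the absolute value only turns
   an integer into a natural number. *)
Definition cut_m (R : realType) (C1 : R) (n d : nat) : nat :=
  `|Num.ceil (C1 * (n%:R ^+ 2 / d%:R ^+ 2) * ln n%:R)|%N.

Definition cut_M (R : realType) (C2 : R) (n md : nat) : nat :=
  minn n `|Num.ceil (C2 * (n%:R / md%:R) * ln n%:R)|%N.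

(* Main.v *)
Require Import Defs.
From HB Require Import structures.
From mathcomp Require Import all_boot all_order all_algebra.
From mathcomp Require Import all_classical all_reals all_analysis.
From mathcomp Require Import ring lra.

Set Implicit Arguments.
Unset Strict Implicit.
Unset Printing Implicit Defensive.

Import Order.TTheory GRing.Theory Num.Theory.
Import numFieldNormedType.Exports.
Local Open Scope ring_scope.

(** Under H_0 each cut degree is a binomial variable of mean at most [q m], so
    an exponential Markov bound and a union bound over U control type I.
    Under H_1 we bound the error for each fixed copy.  The marginals of S and
    of U are uniform, and a union bound needs nothing else: except with
    probability [(1 - M / n) ^ m_d <= 1 / n], U meets the set of vertices of
    degree at least d, and the hypergeometric lower tail gives each such vertex
    at least [d m / (4 n)] planted neighbours in S, which raises the mean of its
    cut degree by twice the margin [(1 - q) d m / (8 n)] of the threshold. *)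

(** * Exponential moments of edge counts in the planted model *)

Lemma sum_powerset_prod (R : comNzRingType) (T : finType) (A : {set T})
    (F : T -> bool -> R) :
  \sum_(E in powerset A) \prod_(p in A) F p (p \in E)
  = \prod_(p in A) (F p true + F p false).
Proof.
(* Outside [A] the factors are 0 for membership and 1 for absence, which kills every [E] not
   contained in [A]; the sum can then run over all sets, as in [bigA_distr]. *)
pose G p := if p \in A then F p true else 0.
pose H p := if p \in A then F p false else 1.
rewrite big_mkcond [RHS]big_mkcond /=.
transitivity (\prod_p (G p + H p)); last first.
  by apply: eq_bigr => p _; rewrite /G /H; case: ifP; rewrite ?add0r.
rewrite bigA_distr /=; apply: eq_big => [E|E _]; first by rewrite inE.
rewrite powersetE; case: ifPn => [/fintype.subsetP EA|/subsetPn[p pE pA]].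
  rewrite big_mkcond /=; apply: eq_bigr => p _; rewrite /G /H.
  have := EA p; case: (p \in E) => [/(_ isT) ->//|_].
  by case: (p \in A).
by rewrite (bigD1 p) //= pE /G (negPf pA) mul0r.
Qed.

(** Inverting [1 - x <= expR (- x)] reduces this to a polynomial inequality. Negative [x] must be
    covered, since the lower tail uses a negative tilt. *)
Lemma expR_le_quadratic (R : realType) (x : R) :
  x <= 1 / 2 -> expR x <= 1 + x + 2 * x ^+ 2.
Proof.
move=> x_le.
have y_gt0 : 0 < 1 - x by lra.
have -> : expR x = (expR (- x))^-1 by rewrite expRN invrK.
apply: (@le_trans _ _ (1 - x)^-1).
  by rewrite lef_pV2 ?posrE ?expR_gt0// expR_ge1Dx.
rewrite -[leLHS]mul1r ler_pdivrMr // -subr_ge0.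
have -> : (1 + x + 2 * x ^+ 2) * (1 - x) - 1 = x ^+ 2 * (1 - 2 * x) by ring.
by apply: mulr_ge0; [exact: sqr_ge0 | lra].
Qed.

Lemma planted_mass_ge0 (R : realType) (n : nat) (q : R)
    (F E : {set {set 'I_n}}) :
  0 < q -> q < 1 -> 0 <= planted_mass q F E.
Proof.
move=> q0 q1; apply: prodr_ge0 => p _.
by case: ifP => _ //; case: ifP => _; lra.
Qed.

Lemma sum_planted_mass (R : realType) (n : nat) (q : R)
    (F : {set {set 'I_n}}) :
  \sum_(E in powerset (pairs n)) planted_mass q F E = 1.
Proof.
rewrite /planted_mass (sum_powerset_prod (pairs n) (fun p b =>
  if p \in F then b%:R else if b then q else 1 - q)).
by apply: big1 => p _; case: ifP => _; rewrite ?addr0 // addrC subrK.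
Qed.

(** Independence turns the moment into a product over pairs. A pair of [P :&: F] contributes exactly
    [expR x]; one of [P :\: F] contributes [1 + q (expR x - 1)], which is at most
    [expR (q x + 2 x^2)] by the quadratic bound. *)
Lemma planted_tail (R : realType) (n : nat) (q : R)
    (F P : {set {set 'I_n}}) (x a : R) :
  0 < q -> q < 1 -> P \subset pairs n -> x <= 1 / 2 ->
  \sum_(E in powerset (pairs n))
     planted_mass q F E * expR (x * (#|E :&: P|%:R - a))
  <= expR (x * (#|P :&: F|%:R + q * #|P :\: F|%:R - a)
           + 2 * x ^+ 2 * #|P|%:R).
Proof.
move=> q0 q1 PP x_le.
pose c := expR (- x * a).
pose K (p : {set 'I_n}) (b : bool) : R :=
  (if p \in F then b%:R else if b then q else 1 - q) *
  (if b && (p \in P) then expR x else 1).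
have restrict (B : {set {set 'I_n}}) (y : R) : B \subset pairs n ->
    y * #|B|%:R = \sum_(p in pairs n) (if p \in B then y else 0).
  move=> /fintype.subsetP BP.
  rewrite -big_mkcondr /= (eq_bigl (mem B)) ?sumr_const ?mulr_natr// => p.
  by rewrite andb_idl // => /BP.
have -> : \sum_(E in powerset (pairs n))
     planted_mass q F E * expR (x * (#|E :&: P|%:R - a)) =
  c * \sum_(E in powerset (pairs n)) \prod_(p in pairs n) K p (p \in E).
  rewrite mulr_sumr; apply: eq_bigr => E.
  rewrite powersetE => EP; rewrite big_split /= -/(planted_mass q F E).
  rewrite mulrCA; congr (_ * _).
  rewrite mulrBr expRD mulrC -mulNr -/c; congr (_ * _).
  rewrite restrict ?(fintype.subset_trans _ EP) ?finset.subsetIl// expR_sum.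
  by apply: eq_bigr => p _; rewrite inE; case: ifP; rewrite ?expR0.
rewrite sum_powerset_prod.
pose e p : R := (if p \in P :&: F then x else 0) +
    (if p \in P :\: F then x * q else 0) + (if p \in P then 2 * x ^+ 2 else 0).
apply: (@le_trans _ _ (c * \prod_(p in pairs n) expR (e p))); last first.
  have PI := fintype.subset_trans (finset.subsetIl P F) PP.
  have PD := fintype.subset_trans (finset.subsetDl P F) PP.
  rewrite -expR_sum /e !big_split /= -!restrict//.
  by rewrite /c -expRD ler_expR le_eqVlt; apply/orP; left; apply/eqP; ring.
rewrite ler_wpM2l ?expR_ge0//; apply: ler_prod => p _.
rewrite /K /e !inE /=; case: (p \in F); case: (p \in P) => /=;
  rewrite ?mul1r ?mul0r ?mulr1 ?addr0 ?add0r ?expR0 ?ler01 ?lexx ?expR_ge0//=.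
- by rewrite ler_expR lerDl mulr_ge0// sqr_ge0.
- have := expR_le_quadratic x_le; have ex := expR_ge0 x => ex2.
  apply/andP; split; first by rewrite addr_ge0 ?mulr_ge0//; lra.
  apply: le_trans (expR_ge1Dx _).
  have : q * expR x <= q * (1 + x + 2 * x ^+ 2) by rewrite ler_wpM2l// ltW.
  have : q * x ^+ 2 <= x ^+ 2 by rewrite ler_piMl ?sqr_ge0// ltW.
  by nra.
- by rewrite addrC subrK ler01 lexx.
Qed.

(** * Uniform random subsets and the hypergeometric law *)

(** Lowering [N] by one multiplies ['C(N, m)] by [1 - m / N], which is at most [1 - m / n] as long
    as [N <= n]; the lemma iterates this [k] times. *)
Lemma bin_sub_le (R : realFieldType) (n m k : nat) :
  (m <= n)%N -> (k <= n)%N -> (0 < n)%N ->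
  'C(n - k, m)%:R <= (1 - m%:R / n%:R) ^+ k * 'C(n, m)%:R :> R.
Proof.
move=> mn kn n0; have nR : 0 < n%:R :> R by rewrite ltr0n.
have r0 : 0 <= 1 - m%:R / n%:R :> R by rewrite subr_ge0 ler_pdivrMr// mul1r ler_nat.
elim: k kn => [_|k IH kn]; first by rewrite subn0 expr0 mul1r.
rewrite exprS -mulrA; apply: le_trans (ler_wpM2l r0 (IH (ltnW kn))).
have nk : 0 < (n - k)%:R :> R by rewrite ltr0n subn_gt0.
have := mul_bin_down (n - k) m; rewrite -subnS => /(congr1 (fun i => i%:R : R)).
rewrite !natrM => bE.
have [mk|mk] := leqP m (n - k); last first.
  rewrite bin_small ?mulr_ge0 ?ler0n//.
  by apply: leq_ltn_trans mk; rewrite leq_sub2l.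
have -> : 'C(n - k.+1, m)%:R = (n - k - m)%:R / (n - k)%:R * 'C(n - k, m)%:R :> R.
  by rewrite mulrAC -bE mulrAC mulfV ?mul1r// gt_eqF.
rewrite ler_wpM2r ?ler0n// (natrB _ mk) mulrBl mulfV ?gt_eqF//.
rewrite lerD2l lerN2 ler_wpM2l ?ler0n// lef_pV2// ler_nat; exact: leq_subr.
Qed.

Lemma card_draws_avoiding (R : realFieldType) (n m : nat) (T : {set 'I_n}) :
  (m <= n)%N -> (0 < n)%N ->
  \sum_(S : {set 'I_n} | #|S| == m) [disjoint T & S]%:R
  <= (1 - m%:R / n%:R) ^+ #|T| * 'C(n, m)%:R :> R.
Proof.
move=> mn n0; apply: le_trans (bin_sub_le _ mn _ n0); last first.
  by rewrite -[leqRHS]card_ord max_card.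
rewrite -natr_sum -big_mkcondr /= sum1dep_card ler_nat.
have -> : (n - #|T|)%N = #|~: T| by rewrite (cardsCs (~: T)) card_ord finset.setCK.
rewrite -cards_draws subset_leq_card//; apply/fintype.subsetP => S.
by rewrite !inE andbC disjoint_sym finset.disjoints_subset.
Qed.

(* Thinning: with 0 <= x <= 1, [x ^+ #|N :&: S|] is the probability that S
   misses the random subset of N keeping each element with probability
   [1 - x].  So the generating function of the hypergeometric variable
   [#|N :&: S|] reduces to avoidance probabilities, and is at most the
   binomial one. *)
Lemma hypergeometric_mgf (R : realFieldType) (n m : nat) (N : {set 'I_n})
    (x : R) :
  (m <= n)%N -> (0 < n)%N -> 0 <= x -> x <= 1 ->
  \sum_(S : {set 'I_n} | #|S| == m) x ^+ #|N :&: S|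
  <= (1 - (1 - x) * (m%:R / n%:R)) ^+ #|N| * 'C(n, m)%:R.
Proof.
move=> mn n0 x0 x1; set r := m%:R / n%:R.
pose w (T : {set 'I_n}) : R := \prod_(i in N) (if i \in T then 1 - x else x).
have thin S : x ^+ #|N :&: S| =
    \sum_(T in powerset N) w T * [disjoint T & S]%:R.
  transitivity (\prod_(i in N) (((1 - x) * (i \notin S)%:R) + x)).
    rewrite -prodr_const [RHS](bigID (mem S)) /= [X in _ = _ * X]big1 ?mulr1; last first.
      by move=> i /andP[_ ->]; rewrite mulr1 subrK.
    apply: eq_big => [i|i]; first by rewrite inE.
    by rewrite inE => /andP[_ ->]; rewrite mulr0 add0r.
  rewrite -(sum_powerset_prod N (fun i b =>
    if b then (1 - x) * (i \notin S)%:R else x)).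
  apply: eq_bigr => T; rewrite powersetE => /fintype.subsetP TN.
  have [dTS|] := boolP [disjoint T & S].
    rewrite mulr1; apply: eq_bigr => i _; case: ifP => // iT.
    by rewrite (disjointFr dTS iT) mulr1.
  move=> /pred0Pn[i /andP[/= iT iS]].
  by rewrite mulr0 (bigD1 i) ?TN//= iT iS mulr0 mul0r.
under eq_bigr do rewrite thin.
rewrite exchange_big /=.
apply: (@le_trans _ _ (\sum_(T in powerset N)
    (\prod_(i in N) (if i \in T then (1 - x) * (1 - r) else x)) * 'C(n, m)%:R)).
  apply: ler_sum => T; rewrite powersetE => /fintype.subsetP TN.
  rewrite -mulr_sumr.
  have w0 : 0 <= w T.
    by apply: prodr_ge0 => i _; case: ifP; rewrite ?subr_ge0.
  apply: le_trans (ler_wpM2l w0 (card_draws_avoiding _ T mn n0)) _.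
  rewrite mulrA ler_wpM2r ?ler0n// -prodr_const -/r.
  have -> : \prod_(i in T) (1 - r) = \prod_(i in N) (if i \in T then 1 - r else 1).
    rewrite -big_mkcondr /=; apply: eq_bigl => i.
    by rewrite andb_idl// => /TN.
  rewrite -big_split /= le_eqVlt; apply/orP; left; apply/eqP.
  by apply: eq_bigr => i _; case: ifP; rewrite ?mulr1.
rewrite -mulr_suml (sum_powerset_prod N (fun i b =>
    if b then (1 - x) * (1 - r) else x)) prodr_const.
by rewrite le_eqVlt; apply/orP; left; apply/eqP; congr (_ ^+ _ * _); ring.
Qed.

(** * Marginals of the seeds *)

Lemma card_compatible_draws (n a b : nat) (S : {set 'I_n}) :
  #|S| = a ->
  #|[set U : {set 'I_n} |
      (#|U| == b) && ((b + a <= n)%N ==> [disjoint U & S])]| =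
  if (b + a <= n)%N then 'C(n - a, b) else 'C(n, b).
Proof.
move=> Sa; case: ifP => _ /=; last first.
  rewrite -[in RHS](card_ord n) -card_draws; apply: eq_card => U.
  by rewrite !inE andbT.
have -> : (n - a)%N = #|~: S| by rewrite (cardsCs (~: S)) card_ord finset.setCK Sa.
rewrite -cards_draws; apply: eq_card => U.
by rewrite !inE andbC finset.disjoints_subset.
Qed.

Lemma mem_cut_seeds (n M m : nat) (w : {set 'I_n} * {set 'I_n}) :
  (w \in cut_seeds n M m) =
  [&& #|w.1| == m, #|w.2| == M & (M + m <= n)%N ==> [disjoint w.2 & w.1]].
Proof. by rewrite inE finset.disjoints_subset. Qed.

(** The number of [U] compatible with [S] depends on the size of [S] only, so [S] is uniform under a
    uniform seed. Both bounds are multiplied out by cardinalities, which avoids dividing by an empty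
    count. *)
Lemma sum_cut_seeds_fst (R : realFieldType) (n M m : nat)
    (f : {set 'I_n} -> R) (e : R) :
  \sum_(S : {set 'I_n} | #|S| == m) f S <= e * 'C(n, m)%:R ->
  \sum_(w in cut_seeds n M m) f w.1 <= e * #|cut_seeds n M m|%:R.
Proof.
pose c := if (M + m <= n)%N then 'C(n - m, M) else 'C(n, M).
have sumE (g : {set 'I_n} -> R) : \sum_(w in cut_seeds n M m) g w.1 =
    (\sum_(S : {set 'I_n} | #|S| == m) g S) * c%:R.
  under eq_bigl do rewrite mem_cut_seeds.
  rewrite -(pair_big_dep (fun S : {set 'I_n} => #|S| == m)
    (fun S U : {set 'I_n} => (#|U| == M) && ((M + m <= n)%N ==> [disjoint U & S]))
    (fun S U => g S)) /= mulr_suml.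
  apply: eq_bigr => S /eqP Sm.
  rewrite /c -(card_compatible_draws M Sm) mulr_natr -sumr_const.
  by apply: eq_bigl => U; rewrite inE.
have drawsE : 'C(n, m)%:R = \sum_(S : {set 'I_n} | #|S| == m) 1 :> R.
  by rewrite -[in LHS](card_ord n) -card_draws -sum1dep_card natr_sum.
move=> fe; have := sumE (fun=> 1); rewrite sumr_const -drawsE => ->.
by rewrite sumE mulrA ler_wpM2r.
Qed.

(** Disjointness is symmetric, so exchanging [S] and [U] carries the seeds for [(M, m)] to those for
    [(m, M)]. *)
Lemma sum_cut_seeds_snd (R : realFieldType) (n M m : nat)
    (f : {set 'I_n} -> R) (e : R) :
  \sum_(U : {set 'I_n} | #|U| == M) f U <= e * 'C(n, M)%:R ->
  \sum_(w in cut_seeds n M m) f w.2 <= e * #|cut_seeds n M m|%:R.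
Proof.
have swapK : involutive (fun w : {set 'I_n} * {set 'I_n} => (w.2, w.1)) by case.
have swapE w : ((w.2, w.1) \in cut_seeds n M m) = (w \in cut_seeds n m M).
  by rewrite !mem_cut_seeds /= andbCA addnC disjoint_sym.
have -> : #|cut_seeds n M m| = #|cut_seeds n m M|.
  rewrite -(card_imset _ (inv_inj swapK)); apply: eq_card => w.
  by rewrite -{1}(swapK w) (mem_imset _ _ (inv_inj swapK)) swapE.
move=> /(sum_cut_seeds_fst m) fe.
by rewrite (reindex_inj (inv_inj swapK)) /= (eq_bigl _ _ swapE).
Qed.

(** * Averaging over seeds and over copies *)

Lemma average_le (R : realFieldType) (T : finType) (A : {set T}) (f : T -> R)
    (e : R) :
  0 <= e -> \sum_(x in A) f x <= e * #|A|%:R ->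
  (\sum_(x in A) f x) / #|A|%:R <= e.
Proof.
(* For empty [A] the quotient is 0, because the inverse of 0 is 0, and [0 <= e] concludes. *)
move=> e0 fe; have [->|A0] := eqVneq #|A| 0%N; first by rewrite invr0 mulr0.
by rewrite ler_pdivrMr // ltr0n lt0n.
Qed.

Section ProbOutput.
Variables (R : realType) (n : nat) (W : finType) (Omega : {set W}).
Variables (A : W -> {set {set 'I_n}} -> bool) (Q : W -> {set {set 'I_n}}).

Lemma prob_output_ge0 (mass : {set {set 'I_n}} -> R) (b : bool) :
  (forall E, 0 <= mass E) -> 0 <= prob_output Omega mass A Q b.
Proof.
move=> mass0; apply: sumr_ge0 => E _; rewrite mulr_ge0// divr_ge0 ?ler0n//.
by apply: sumr_ge0 => w _; rewrite ler0n.
Qed.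

Lemma prob_output_le (mass : {set {set 'I_n}} -> R) (b : bool) (h : W -> R)
    (e : R) :
  0 <= e ->
  (forall w, w \in Omega ->
     \sum_(E in powerset (pairs n)) mass E * (A w (E :&: Q w) == b)%:R <= h w) ->
  \sum_(w in Omega) h w <= e * #|Omega|%:R ->
  prob_output Omega mass A Q b <= e.
Proof.
move=> e0 Ah he; rewrite /prob_output.
under eq_bigr do rewrite mulrA mulr_sumr.
rewrite -mulr_suml exchange_big /=; apply: average_le => //.
by apply: le_trans he; apply: ler_sum.
Qed.

(** [mass_H1] is an average over copies and the output probability is linear in the mass. *)
Lemma prob_output_H1_le (q : R) (G : sgraph) (b : bool) (e : R) :
  0 <= e ->
  (forall H, H \in copies n G ->
     prob_output Omega (planted_mass q H.2) A Q b <= e) ->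
  prob_output Omega (mass_H1 q G) A Q b <= e.
Proof.
move=> e0 He; rewrite /prob_output /mass_H1.
under eq_bigr do rewrite mulrAC mulr_suml.
rewrite -mulr_suml exchange_big /=; apply: average_le => //.
by rewrite mulr_natr -[leRHS]sumr_const; apply: ler_sum.
Qed.

End ProbOutput.

(** * Stars, cut degrees and planted neighbourhoods *)

(** Removing [v] from [S] discards the singleton [[set v; v]], so a star consists of pairs only; it
    has one pair fewer than [S] has elements when [v] lies in [S]. *)
Definition star (n : nat) (v : 'I_n) (S : {set 'I_n}) : {set {set 'I_n}} :=
  [set [set v; s] | s in S :\ v].

Section Star.
Variable n : nat.
Implicit Types (v : 'I_n) (S U : {set 'I_n}) (B E : {set {set 'I_n}}).

Lemma star_sub_pairs v S : star v S \subset pairs n.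
Proof.
apply/fintype.subsetP => p /imsetP[s]; rewrite !inE => /andP[sv _] ->.
by move: sv; rewrite eq_sym cards2 => ->.
Qed.

Lemma pair_inj v S : {in S :\ v &, injective (fun s : 'I_n => [set v; s])}.
Proof.
move=> s t; rewrite !inE => /andP[sv _] _ /setP/(_ s).
by rewrite !inE eqxx orbT (negPf sv) => /esym/eqP.
Qed.

Lemma card_star v S : #|star v S| = #|S :\ v|.
Proof. by rewrite card_in_imset//; exact: pair_inj. Qed.

Lemma card_starI v S B :
  #|star v S :&: B| = #|[set s in S :\ v | [set v; s] \in B]|.
Proof.
rewrite -(card_in_imset (f := fun s : 'I_n => [set v; s])); last first.
  by move=> s t /setIdP[+ _] /setIdP[+ _]; exact: pair_inj.
apply: eq_card => p; rewrite inE; apply/andP/imsetP.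
  by move=> [/imsetP[s sS ->] sB]; exists s => //; rewrite inE sS.
by move=> [s /setIdP[sS sB] ->]; split => //; apply/imsetP; exists s.
Qed.

(** Every pair joining [v] to [S] is queried. The cut degree is thus an edge count over a set of
    pairs fixed by the seed, to which [planted_tail] applies. *)
Lemma cut_degreeE (w : {set 'I_n} * {set 'I_n}) E v :
  E \subset pairs n -> v \in w.2 ->
  cut_degree w.1 (E :&: cut_queries w) v = #|E :&: star v w.1|.
Proof.
move=> /fintype.subsetP EP vU; rewrite [in RHS]finset.setIC card_starI.
apply: eq_card => s; rewrite !inE.
have [sE|] := boolP ([set v; s] \in E); last by rewrite !andbF.
have := EP _ sE; rewrite inE cards2 => vs; rewrite vs.
have -> : s != v by move: vs; rewrite (eq_sym v); case: (s == v).
case: (boolP (s \in w.1)) => //= sS.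
apply/existsP; exists v; rewrite vU /=; apply/existsP; exists s.
by rewrite sS /=.
Qed.

Lemma cut_queries_card (w : {set 'I_n} * {set 'I_n}) :
  (#|cut_queries w| <= #|w.2| * #|w.1|)%N.
Proof.
rewrite -cardsX; apply: leq_trans (leq_imset_card (fun x => [set x.1; x.2]) _).
apply/subset_leq_card/fintype.subsetP => p; rewrite inE => /andP[_].
move=> /existsP[u /andP[uU /existsP[s /andP[sS /eqP ->]]]].
by apply/imsetP; exists (u, s); rewrite ?inE/= ?uU.
Qed.

End Star.

(** The embedding injects each neighbourhood in [G] into one in the copy. Only the size of [V] and
    the degree bound are kept, which makes the type II bound uniform over copies. *)
Lemma copy_high_degree (n : nat) (G : sgraph) (d : nat)
    (H : {set 'I_n} * {set {set 'I_n}}) :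
  H \in copies n G ->
  exists2 V : {set 'I_n}, #|V| = num_deg_ge G d &
    forall v, v \in V -> (d <= #|[set s | (s != v) && ([set v; s] \in H.2)]|)%N.
Proof.
rewrite inE => /andP[_ /existsP[f /and3P[/injectiveP f_inj _ /forallP fadj]]].
exists (f @: [set x : G | (d <= deg x)%N]); first by rewrite card_imset.
move=> v /imsetP[x]; rewrite inE => dx ->; apply: leq_trans dx _.
rewrite /deg -(card_imset _ f_inj); apply/subset_leq_card/fintype.subsetP => s.
move=> /imsetP[y]; rewrite !inE => xy ->.
rewrite -(eqP (forallP (fadj x) y)) xy andbT (inj_eq f_inj).
by apply: contraTneq xy => ->; rewrite adj_irr.
Qed.

(** * Hypergeometric and Chernoff tail bounds *)

(** Exponential Markov bound with tilt 1. With [r = m / n] the exponent is at most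
    [k - (1 - expR (- 1)) r #|N|]. Since [expR (- 1) <= 1 / 2] and [#|N| r >= d r = 4 k], it is at
    most [k - 2 k]. *)
Lemma hypergeometric_tail (R : realType) (n m d : nat) (N : {set 'I_n})
    (k : R) :
  (m <= n)%N -> (0 < n)%N -> (d <= #|N|)%N ->
  k = d%:R * m%:R / (4 * n%:R) ->
  \sum_(S : {set 'I_n} | #|S| == m) (#|N :&: S|%:R < k)%R%:R
  <= expR (- k) * 'C(n, m)%:R.
Proof.
move=> mn n0 dN k_def; have nR : 0 < n%:R :> R by rewrite ltr0n.
pose x : R := expR (- 1).
have x0 : 0 <= x by exact: expR_ge0.
have x2 : x <= 1 / 2.
  rewrite /x expRN div1r lef_pV2 ?posrE ?expR_gt0//.
  by have := expR_ge1Dx (1 : R); lra.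
pose r : R := m%:R / n%:R.
have r0 : 0 <= r by rewrite divr_ge0 ?ler0n.
have r1 : r <= 1 by rewrite ler_pdivrMr// mul1r ler_nat.
apply: (@le_trans _ _ (expR k * \sum_(S : {set 'I_n} | #|S| == m) x ^+ #|N :&: S|)).
  rewrite mulr_sumr; apply: ler_sum => S _.
  rewrite /x -expRM_natl mulrN1 -expRD.
  have [lt_k|_] := ltP; last exact: expR_ge0.
  by apply: le_trans (expR_ge1Dx _); rewrite lerDl subr_ge0 ltW.
have x1 : x <= 1 by lra.
apply: le_trans (ler_wpM2l (expR_ge0 _) (hypergeometric_mgf N mn n0 x0 x1)) _.
rewrite mulrA ler_wpM2r ?ler0n// -/r.
have xr : (1 - x) * r <= 1 by rewrite mulr_ile1//; lra.
apply: (@le_trans _ _ (expR k * expR (- ((1 - x) * r)) ^+ #|N|)).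
  rewrite ler_wpM2l ?expR_ge0// lerXn2r ?nnegrE ?expR_ge0//; first lra.
  exact: expR_ge1Dx.
rewrite -expRM_natl -expRD ler_expR.
have kE : k = d%:R * r / 4 by rewrite k_def /r; field; rewrite gt_eqF.
have : d%:R * r <= #|N|%:R * r by rewrite ler_wpM2r// ler_nat.
have : #|N|%:R * r * (1 / 2) <= #|N|%:R * r * (1 - x).
  by rewrite ler_wpM2l ?mulr_ge0//; lra.
rewrite kE; lra.
Qed.

(* In the test, [l = (1 - q) d / (32 n)] is the exponential tilt that optimizes
   the Chernoff bound at the threshold [q m + 4 l m]. *)
Section Tails.
Variables (R : realType) (n : nat) (q l : R) (m : nat).
Hypotheses (q_gt0 : 0 < q) (q_lt1 : q < 1) (l_ge0 : 0 <= l) (l_le : l <= 1 / 2).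
Let T := q * m%:R + 4 * l * m%:R.

(** At tilt [l] the exponent is at most [l (q m - T) + 2 l^2 m], that is [- 4 l^2 m + 2 l^2 m]. *)
Lemma upper_tail (P : {set {set 'I_n}}) :
  P \subset pairs n -> (#|P| <= m)%N ->
  \sum_(E in powerset (pairs n)) mass_H0 q E * (T <= #|E :&: P|%:R)%R%:R
  <= expR (- (2 * l ^+ 2 * m%:R)).
Proof.
move=> PP Pm.
apply: le_trans (le_trans (planted_tail finset.set0 T q_gt0 q_lt1 PP l_le) _).
  apply: ler_sum => E _; rewrite ler_wpM2l ?planted_mass_ge0//.
  have [TE|_] := leP T; last exact: expR_ge0.
  apply: le_trans (expR_ge1Dx _); rewrite lerDl mulr_ge0// subr_ge0//.
rewrite finset.setI0 finset.setD0 cards0 ler_expR.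
have Pm' : #|P|%:R <= m%:R :> R by rewrite ler_nat.
have : l * q * #|P|%:R <= l * q * m%:R by rewrite ler_wpM2l// mulr_ge0// ltW.
have : l ^+ 2 * #|P|%:R <= l ^+ 2 * m%:R by rewrite ler_wpM2l// sqr_ge0.
rewrite /T; lra.
Qed.

(** At tilt [- l] the planted pairs contribute [- 8 l^2 m], the margin of [T] costs [4 l^2 m] and
    the quadratic term [2 l^2 m]. The extra 1 pays for a star with [m - 1] pairs, whose missing pair
    costs [l q <= 1]. *)
Lemma lower_tail (F P : {set {set 'I_n}}) (k : R) :
  P \subset pairs n -> (#|P| <= m)%N -> (m <= #|P|.+1)%N ->
  k <= #|P :&: F|%:R -> (1 - q) * k = 8 * l * m%:R ->
  \sum_(E in powerset (pairs n)) planted_mass q F E * (#|E :&: P|%:R < T)%R%:R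
  <= expR (1 - 2 * l ^+ 2 * m%:R).
Proof.
move=> PP Pm mP kF kE.
have Nl_le : - l <= 1 / 2 by move: l_ge0; lra.
apply: le_trans (le_trans (planted_tail F T q_gt0 q_lt1 PP Nl_le) _).
  apply: ler_sum => E _; rewrite ler_wpM2l ?planted_mass_ge0//.
  have [TE|_] := ltP; last exact: expR_ge0.
  apply: le_trans (expR_ge1Dx _).
  by rewrite lerDl mulNr -mulrN opprB mulr_ge0// subr_ge0 ltW.
rewrite ler_expR sqrrN.
have Pm' : #|P|%:R <= m%:R :> R by rewrite ler_nat.
have mP' : m%:R <= #|P|%:R + 1 :> R by rewrite natr1 ler_nat.
have PE : #|P|%:R = #|P :&: F|%:R + #|P :\: F|%:R :> R.
  by rewrite -natrD cardsID.
have : (l * (1 - q)) * k <= (l * (1 - q)) * #|P :&: F|%:R.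
  by rewrite ler_wpM2l// mulr_ge0// subr_ge0 ltW.
have : l * q * m%:R <= l * q * (#|P|%:R + 1) by rewrite ler_wpM2l// mulr_ge0// ltW.
have : l ^+ 2 * #|P|%:R <= l ^+ 2 * m%:R by rewrite ler_wpM2l// sqr_ge0.
have : l * q <= 1.
  by rewrite mulr_ile1//; [exact: ltW | move: l_le; lra | exact: ltW].
have : l * ((1 - q) * k) = l * (8 * l * m%:R) by rewrite kE.
rewrite /T PE; lra.
Qed.

End Tails.

(** * Error probabilities of the test at fixed parameters *)

Section CutTest.
Variables (R : realType) (n : nat) (q l : R) (M m d : nat).
Hypotheses (q_gt0 : 0 < q) (q_lt1 : q < 1).
Hypotheses (n_gt0 : (0 < n)%N) (m_gt0 : (0 < m)%N) (m_le : (m <= n)%N).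
Hypotheses (M_le : (M <= n)%N) (d_gt0 : (0 < d)%N) (d_le : (d <= n)%N).
Hypothesis lE : l = (1 - q) * d%:R / (32 * n%:R).

Let nR : 0 < n%:R :> R. Proof. by rewrite ltr0n. Qed.

Let l_gt0 : 0 < l.
Proof. by rewrite lE divr_gt0 ?mulr_gt0 ?ltr0n// subr_gt0. Qed.

Let l_le : l <= 1 / 2.
Proof.
rewrite lE ler_pdivrMr ?mulr_gt0//.
have dn : d%:R <= n%:R :> R by rewrite ler_nat.
have : (1 - q) * d%:R <= d%:R by rewrite ler_piMl ?ler0n//; move: q_gt0; lra.
by move: nR; lra.
Qed.

Let thresholdE : cut_threshold n q m d = q * m%:R + 4 * l * m%:R.
Proof. by rewrite /cut_threshold lE; field; rewrite gt_eqF. Qed.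

Lemma cut_test_type1 (w : {set 'I_n} * {set 'I_n}) :
  w \in cut_seeds n M m ->
  \sum_(E in powerset (pairs n))
    mass_H0 q E * (cut_test q m d w (E :&: cut_queries w) == true)%:R
  <= n%:R * expR (- (2 * l ^+ 2 * m%:R)).
Proof.
rewrite mem_cut_seeds => /and3P[/eqP Sm /eqP UM _].
apply: (@le_trans _ _ (\sum_(u in w.2) \sum_(E in powerset (pairs n))
    mass_H0 q E * (q * m%:R + 4 * l * m%:R <= #|E :&: star u w.1|%:R)%R%:R)).
  rewrite exchange_big /=; apply: ler_sum => E; rewrite powersetE => EP.
  rewrite -mulr_sumr ler_wpM2l ?planted_mass_ge0// eqb_id.
  have [|_] := boolP (cut_test _ _ _ _ _); last first.
    by apply: sumr_ge0 => u _; rewrite ler0n.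
  (* For empty [U] the maximum is 0, below the threshold, which is positive because [m > 0]. *)
  rewrite /cut_test thresholdE; have [U0|U0] := posnP #|w.2|.
    rewrite big_pred0 => [|u]; last by rewrite (card0_eq U0).
    by rewrite leNgt addr_gt0 ?mulr_gt0 ?ltr0n.
  have [u uU ->] := eq_bigmax_cond (cut_degree w.1 (E :&: cut_queries w)) U0.
  rewrite cut_degreeE// => le_u; rewrite (bigD1 u)//= le_u lerDl.
  by apply: sumr_ge0 => v _; rewrite ler0n.
apply: (@le_trans _ _ (\sum_(u in w.2) expR (- (2 * l ^+ 2 * m%:R)))).
  apply: ler_sum => u _; apply: upper_tail => //; first exact: ltW.
    exact: star_sub_pairs.
  by rewrite card_star -Sm subset_leq_card// finset.subsetDl.
by rewrite sumr_const UM -[leLHS]mulr_natl ler_wpM2r ?expR_ge0// ler_nat.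
Qed.

Section Type2.
Variables (F : {set {set 'I_n}}) (V : {set 'I_n}).
Let nbh (v : 'I_n) := [set s | (s != v) && ([set v; s] \in F)].
Hypothesis V_deg : forall v, v \in V -> (d <= #|nbh v|)%N.
Let k : R := d%:R * m%:R / (4 * n%:R).

(** If [U] meets [V] and no vertex of [V] has few planted neighbours in [S], the lower tail at a
    single vertex of [V] in [U] suffices. Summing over all of [V], not only over that vertex, makes
    the second term depend on [S] alone, so that the marginals of [S] and [U] are enough later. *)
Lemma cut_test_type2_seed (w : {set 'I_n} * {set 'I_n}) :
  w \in cut_seeds n M m ->
  \sum_(E in powerset (pairs n))
    planted_mass q F E * (cut_test q m d w (E :&: cut_queries w) == false)%:R
  <= [disjoint V & w.2]%:R + \sum_(v in V) (#|nbh v :&: w.1|%:R < k)%R%:R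
     + expR (1 - 2 * l ^+ 2 * m%:R).
Proof.
rewrite mem_cut_seeds => /and3P[/eqP Sm _ _].
have mass_le1 (f : {set {set 'I_n}} -> bool) :
    \sum_(E in powerset (pairs n)) planted_mass q F E * (f E)%:R <= 1.
  rewrite -[leRHS](sum_planted_mass q F); apply: ler_sum => E _.
  by rewrite ler_piMr ?planted_mass_ge0// lern1 leq_b1.
have sum0 : 0 <= \sum_(v in V) (#|nbh v :&: w.1|%:R < k)%R%:R :> R.
  by apply: sumr_ge0 => v _; rewrite ler0n.
have e0 : 0 <= expR (1 - 2 * l ^+ 2 * m%:R) by exact: expR_ge0.
have [_|] := boolP [disjoint V & w.2].
  by apply: le_trans (mass_le1 _) _; rewrite mulr1n; lra.
move=> /pred0Pn[v /andP[/= vV vU]]; rewrite add0r.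
have [few|many] := ltP #|nbh v :&: w.1|%:R k.
  apply: le_trans (mass_le1 _) _; rewrite (bigD1 v)//= few mulr1n.
  rewrite -addrA lerDl addr_ge0//; apply: sumr_ge0 => u _; exact: ler0n.
rewrite -[leLHS]add0r lerD//.
have kE : (1 - q) * k = 8 * l * m%:R.
  by rewrite /k lE; field; rewrite gt_eqF.
have F_many : k <= #|star v w.1 :&: F|%:R.
  rewrite card_starI; apply: le_trans many _; rewrite ler_nat.
  apply/subset_leq_card/fintype.subsetP => s; rewrite !inE.
  by move=> /andP[/andP[-> ->] ->].
apply: le_trans (lower_tail q_gt0 q_lt1 (ltW l_gt0) l_le (star_sub_pairs v w.1)
  _ _ F_many kE).
- apply: ler_sum => E; rewrite powersetE => EP.
  rewrite ler_wpM2l ?planted_mass_ge0// ler_nat eqbF_neg /cut_test thresholdE.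
  rewrite -ltNge; have [lt_max|//] := ltP.
  have [//|] := ltP; rewrite leNgt => /negP[]; apply: le_lt_trans lt_max.
  by rewrite ler_nat -(cut_degreeE EP vU) leq_bigmax_cond.
- by rewrite card_star -Sm subset_leq_card// finset.subsetDl.
(* When [S] and [U] overlap, [v] may belong to [S], and its star then has only [m - 1] pairs. *)
- by rewrite card_star -Sm (cardsD1 v) -add1n leq_add2r leq_b1.
Qed.

Lemma cut_test_type2 :
  prob_output (cut_seeds n M m) (planted_mass q F) (cut_test q m d) cut_queries
    false
  <= (1 - M%:R / n%:R) ^+ #|V| + n%:R * expR (- k)
     + expR (1 - 2 * l ^+ 2 * m%:R).
Proof.
have r0 : 0 <= 1 - M%:R / n%:R :> R.
  by rewrite subr_ge0 ler_pdivrMr// mul1r ler_nat.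
apply: (prob_output_le _ cut_test_type2_seed).
  by rewrite !addr_ge0 ?exprn_ge0 ?mulr_ge0 ?expR_ge0.
rewrite !big_split /= !mulrDl; apply: lerD; first apply: lerD.
- exact: (sum_cut_seeds_snd _ (card_draws_avoiding _ V M_le n_gt0)).
- rewrite exchange_big /=.
  apply: (@le_trans _ _ (\sum_(v in V) expR (- k) * #|cut_seeds n M m|%:R)).
    apply: ler_sum => v vV; apply: (@sum_cut_seeds_fst R n M m
      (fun S => (#|nbh v :&: S|%:R < k)%R%:R)).
    exact: hypergeometric_tail (V_deg vV) _.
  rewrite sumr_const -[leLHS]mulr_natl mulrA ler_wpM2r ?ler0n//.
  by rewrite ler_wpM2r ?expR_ge0// ler_nat -[leqRHS]card_ord max_card.
- by rewrite sumr_const -[leLHS]mulr_natr.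
Qed.

End Type2.

Lemma cut_test_risk (G : sgraph) :
  risk q G (cut_seeds n M m) (cut_test q m d) cut_queries
  <= n%:R * expR (- (2 * l ^+ 2 * m%:R))
     + ((1 - M%:R / n%:R) ^+ num_deg_ge G d
        + n%:R * expR (- (d%:R * m%:R / (4 * n%:R)))
        + expR (1 - 2 * l ^+ 2 * m%:R)).
Proof.
have r0 : 0 <= 1 - M%:R / n%:R :> R.
  by rewrite subr_ge0 ler_pdivrMr// mul1r ler_nat.
apply: lerD.
  apply: (prob_output_le _ cut_test_type1); first by rewrite mulr_ge0 ?expR_ge0.
  by rewrite sumr_const -[leLHS]mulr_natr.
apply: prob_output_H1_le => [|H HG].
  by rewrite !addr_ge0 ?exprn_ge0 ?mulr_ge0 ?expR_ge0.
have [V <- V_deg] := copy_high_degree d HG; exact: cut_test_type2.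
Qed.

End CutTest.

(** * Choice of the sample sizes and the limit *)

Lemma risk_ge0 (R : realType) (n : nat) (q : R) (G : sgraph) (W : finType)
    (Omega : {set W}) (A : W -> {set {set 'I_n}} -> bool)
    (Q : W -> {set {set 'I_n}}) :
  0 < q -> q < 1 -> 0 <= risk q G Omega A Q.
Proof.
move=> q0 q1; rewrite addr_ge0// prob_output_ge0// => E.
  exact: planted_mass_ge0.
by rewrite divr_ge0// sumr_ge0// => H _; exact: planted_mass_ge0.
Qed.

Lemma cut_m_ge (R : realType) (C1 : R) (n d : nat) :
  C1 * (n%:R ^+ 2 / d%:R ^+ 2) * ln n%:R <= (cut_m C1 n d)%:R.
Proof.
rewrite /cut_m natr_absz; apply: le_trans (ceil_ge _) _.
by rewrite ler_int ler_norm.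
Qed.

(** If the minimum is [n], the base is 0 and [k > 0] makes the power vanish. Otherwise
    [M >= (n / k) ln n], and [(1 - M / n) ^ k <= expR (- (k M / n)) <= 1 / n]. *)
Lemma missed_le (R : realType) (C2 : R) (n k : nat) :
  1 <= C2 -> (0 < n)%N -> (0 < k)%N ->
  (1 - (cut_M C2 n k)%:R / n%:R) ^+ k <= (n%:R)^-1 :> R.
Proof.
move=> C2_ge1 n0 k0; have nR : 0 < n%:R :> R by rewrite ltr0n.
have kR : 0 < k%:R :> R by rewrite ltr0n.
rewrite /cut_M; set c := `|_|%N; have [nc|/ltnW cn] := leqP n c.
  by rewrite mulfV ?gt_eqF// subrr expr0n eqn0Ngt k0/= invr_ge0 ltW.
have c_ge : n%:R / k%:R * ln n%:R <= c%:R :> R.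
  apply: (@le_trans _ _ (C2 * (n%:R / k%:R) * ln n%:R)).
    by rewrite -[leRHS]mulrA ler_peMl// mulr_ge0 ?divr_ge0 ?ln_ge0 ?ler1n.
  by rewrite natr_absz; apply: le_trans (ceil_ge _) _; rewrite ler_int ler_norm.
apply: (@le_trans _ _ (expR (- (c%:R / n%:R)) ^+ k)).
  rewrite lerXn2r ?nnegrE ?expR_ge0 ?expR_ge1Dx//.
  by rewrite subr_ge0 ler_pdivrMr// mul1r ler_nat.
rewrite -expRM_natl -[leRHS]lnK ?posrE ?invr_gt0// ler_expR lnV ?posrE//.
rewrite mulrN lerN2 mulrA ler_pdivlMr//.
by rewrite [leLHS]mulrC [leRHS]mulrC -ler_pdivrMr// mulrAC.
Qed.

(** Both exponential rates are at least [2 ln n], so a union bound over [n] events still leaves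
    [1 / n]. Substituting [l] and [m] gives [2 l^2 m >= C1 (1 - q)^2 ln n / 512], whence the
    constant 1024. *)
Lemma cut_test_risk_le (R : realType) (q C1 C2 : R) (n d : nat) (G : sgraph) :
  0 < q -> q < 1 -> 1024 / (1 - q) ^+ 2 <= C1 -> 1 <= C2 ->
  (1 < n)%N -> (#|G| <= n)%N -> (1 <= d <= max_deg G)%N ->
  let m := cut_m C1 n d in
  let M := cut_M C2 n (num_deg_ge G d) in
  (m <= n)%N ->
  risk q G (cut_seeds n M m) (cut_test q m d) cut_queries
  <= (3 + expR 1) / n%:R.
Proof.
move=> q0 q1 C1_ge C2_ge n1 Gn /andP[d0 d_max] m M m_le.
have n0 := ltnW n1.
have M_le : (M <= n)%N by exact: geq_minl.
have nR : 0 < n%:R :> R by rewrite ltr0n.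
have dR : 0 < d%:R :> R by rewrite ltr0n.
(* A vertex of maximum degree shows that [num_deg_ge G d] is positive and that [d <= n]. *)
have [x dx] : exists x : G, (d <= deg x)%N.
  have G0 : (0 < #|G|)%N.
    rewrite lt0n; apply: contraTneq d_max => /card0_eq G0.
    by rewrite /max_deg big_pred0// -ltnNge.
  have [x _ xE] := eq_bigmax_cond (@deg G) G0.
  by exists x; rewrite -xE.
have V0 : (0 < num_deg_ge G d)%N by apply/card_gt0P; exists x; rewrite inE.
have d_le : (d <= n)%N.
  by apply: leq_trans dx (leq_trans _ Gn); exact: max_card.
pose L : R := ln n%:R.
have L0 : 0 < L by rewrite ln_gt0// ltr1n.
have q1' : 0 < 1 - q by rewrite subr_gt0.
have C1q : 1024 <= C1 * (1 - q) ^+ 2 by rewrite -ler_pdivrMr ?exprn_gt0.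
(* The hypergeometric rate [d m / (4 n)] is at least [C1 (n / d) ln n / 4]; with [d <= n], the value
   8 makes it [2 ln n]. *)
have C1_8 : 8 <= C1.
  have : (1 - q) ^+ 2 <= 1 by rewrite expr_le1//; lra.
  by nra.
have m_ge : C1 * n%:R ^+ 2 / d%:R ^+ 2 * L <= m%:R.
  by apply: le_trans (cut_m_ge _ _ _); rewrite !mulrA.
have m_gt0 : (0 < m)%N.
  rewrite -(ltr0n R); apply: lt_le_trans m_ge.
  by rewrite mulr_gt0// divr_gt0 ?mulr_gt0 ?exprn_gt0//; lra.
pose l := (1 - q) * d%:R / (32 * n%:R).
apply: le_trans (cut_test_risk q0 q1 n0 m_gt0 m_le M_le d0 d_le
  (erefl l) G) _.
have rate1 : 2 * L <= 2 * l ^+ 2 * m%:R.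
  apply: (@le_trans _ _ (2 * l ^+ 2 * (C1 * n%:R ^+ 2 / d%:R ^+ 2 * L))).
    have -> : 2 * l ^+ 2 * (C1 * n%:R ^+ 2 / d%:R ^+ 2 * L) =
        C1 * (1 - q) ^+ 2 * L / 512.
      by rewrite /l; field; rewrite !gt_eqF.
    have : 1024 * L <= C1 * (1 - q) ^+ 2 * L by rewrite ler_wpM2r// ltW.
    by lra.
  by rewrite ler_wpM2l// mulr_ge0// sqr_ge0.
have rate2 : 2 * L <= d%:R * m%:R / (4 * n%:R).
  rewrite ler_pdivlMr ?mulr_gt0//.
  apply: (@le_trans _ _ (d%:R * (C1 * n%:R ^+ 2 / d%:R ^+ 2 * L))); last first.
    by rewrite ler_wpM2l// ltW.
  have -> : d%:R * (C1 * n%:R ^+ 2 / d%:R ^+ 2 * L) = C1 * L * n%:R * (n%:R / d%:R).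
    by field; rewrite gt_eqF.
  have nd : 1 <= n%:R / d%:R :> R by rewrite ler_pdivlMr// mul1r ler_nat.
  have CLn : 8 * (L * n%:R) <= C1 * L * n%:R.
    by rewrite -mulrA ler_wpM2r// mulr_ge0// ltW.
  apply: (@le_trans _ _ (C1 * L * n%:R)); first by lra.
  by rewrite ler_peMr//; apply: le_trans CLn; rewrite !mulr_ge0// ltW.
have nK : n%:R * expR (- (2 * L)) = n%:R^-1.
  rewrite mulrDl mul1r opprD expRD expRN /L lnK ?posrE//.
  by rewrite mulrA mulfV ?mul1r// gt_eqF.
have decay r : 2 * L <= r -> n%:R * expR (- r) <= n%:R^-1.
  by move=> Lr; rewrite -nK ler_wpM2l ?ler0n// ler_expR lerN2.
have last_le : expR (1 - 2 * l ^+ 2 * m%:R) <= expR 1 / n%:R.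
  rewrite expRD ler_wpM2l ?expR_ge0//; apply: le_trans (decay _ rate1).
  by rewrite ler_peMl ?expR_ge0// ler1n.
(* Type I error, missing [V] and few planted neighbours cost [1 / n] each; the lower tail costs
   [expR 1 / n]. *)
have -> : (3 + expR 1) / n%:R = n%:R^-1 + (n%:R^-1 + n%:R^-1 + expR 1 / n%:R) :> R.
  by field; rewrite gt_eqF.
by apply: lerD; [exact: decay | apply: lerD => //; apply: lerD;
  [exact: missed_le | exact: decay]].
Qed.

Local Open Scope classical_set_scope.

Theorem theorem4 (R : realType) (q : R) (q_gt0 : 0 < q) (q_lt1 : q < 1) :
  exists c1 c2 : R, [/\ 0 < c1, 0 < c2 &
  forall C1 C2 : R, c1 <= C1 -> c2 <= C2 ->
  forall (Gamma : nat -> sgraph) (d : nat -> nat),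
  (forall n, no_isolated (Gamma n)) ->
  (forall n, (#|Gamma n| <= n)%N) ->
  let m n := cut_m C1 n (d n) in
  let M n := cut_M C2 n (num_deg_ge (Gamma n) (d n)) in
  (\forall n \near \oo, (1 <= d n <= max_deg (Gamma n))%N) ->
  (\forall n \near \oo, (m n)%:R <= n%:R / 2 :> R) ->
  (\forall n \near \oo,
     10 * ln n%:R <= #|Gamma n|%:R * (m n)%:R / n%:R :> R) ->
  exists Q : forall n, {set 'I_n} * {set 'I_n} -> {set {set 'I_n}},
    (forall n w, w \in cut_seeds n (M n) (m n) ->
       [/\ Q n w \subset pairs n, cut_queries w \subset Q n w &
           (#|Q n w| <= M n * m n)%N]) /\
    risk q (Gamma n) (cut_seeds n (M n) (m n)) (cut_test q (m n) (d n)) (Q n)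
      @[n --> \oo] --> (0 : R)].
Proof.
exists (1024 / (1 - q) ^+ 2), 1; split.
- by apply: divr_gt0; [rewrite ltr0n | rewrite exprn_gt0// subr_gt0].
- exact: ltr01.
move=> C1 C2 C1_ge C2_ge Gamma d _ Gamma_le m M d_near m_near _.
exists (fun n => @cut_queries n); split.
  move=> n w; rewrite mem_cut_seeds => /and3P[/eqP Sm /eqP UM _]; split => //.
    by apply/fintype.subsetP => p /setIdP[].
  by rewrite -Sm -UM cut_queries_card.
(* The bound [(3 + expR 1) / n] is explicit, so it drops below [e] once [n >= (3 + expR 1) / e]. *)
apply/cvgr0Pnorm_le => e e0; near=> n.
have n1 : (1 < n)%N by near: n; exact: nbhs_infty_gt.
have nR : 0 < n%:R :> R by rewrite ltr0n ltnW.
have dn : (1 <= d n <= max_deg (Gamma n))%N by near: n.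
have mn : (m n <= n)%N.
  have m2 : (m n)%:R <= n%:R / 2 :> R by near: n.
  by rewrite -(ler_nat R); lra.
rewrite ger0_norm ?risk_ge0//.
apply: le_trans (cut_test_risk_le q_gt0 q_lt1 C1_ge C2_ge n1 (Gamma_le n) dn mn) _.
rewrite ler_pdivrMr// mulrC -ler_pdivrMr//.
near: n; exact: nbhs_infty_ger.
Unshelve. all: by end_near.
Qed.
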